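(* Let $k,m,n\in\mathbb N$ with $m\leq n$, let $M$ be a $k\times m$ matrix with entries from $\mathbb Q$, let $F=\{h_{\vec x}:\vec x\in\mathbb A^n\}$, and let $\sigma$ and $\eta$ be injections from $\{1,\dots,m\}$ to $\{1,\dots,n\}$. Then $P_{M,F,\sigma}=P_{M,F,\eta}$.
   Context: $\mathbb A$ is a fixed nonempty finite alphabet, $S_0=\mathbb A^+$ the free semigroup of nonempty words over $\mathbb A$, and $S_n$ the set of nonempty words over $\mathbb A\cup\{v_1,\dots,v_n\}$ (distinct variables not in $\mathbb A$) in which each $v_i$ occurs. For $\vec x\in\mathbb A^n$, $h_{\vec x}:S_n\to S_0$ is $h_{\vec x}(w)=w(\vec x)$, the word obtained by replacing each $v_i$ by $x_i$. $\mu_j(w)=|w|_{v_j}$. For a finite nonempty set $F$ of homomorphisms $S_n\to S_0$ and an injection $\sigma:\{1,\dots,m\}\to\{1,\dots,n\}$, $P_{M,F,\sigma}$ is the set of $\vec p=(p_1,\dots,p_k)\in(\beta\mathbb N)^k$ such that whenever $D$ is a piecewise syndetic subset of $S_0$ and $B_i\in p_i$ for all $i\le k$, there exists $w\in S_n$ with $\nu(w)\in D$ for all $\nu\in F$ and $M(\mu_{\sigma(1)}(w),\dots,\mu_{\sigma(m)}(w))^{T}\in\prod_{i=1}^kB_i$. Here $\beta X$ is the Stone–Čech compactification (ultrafilters) of the discrete semigroup $X$, $K(\beta X)$ its smallest ideal, and $D\subseteq X$ is piecewise syndetic if $D\in p$ for some $p\in K(\beta X)$. *)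

(* Defs.v *)
From HB Require Import structures.
From mathcomp Require Import all_boot all_algebra all_classical.

Set Implicit Arguments.
Unset Strict Implicit.
Unset Printing Implicit Defensive.

Local Open Scope classical_set_scope.
Local Open Scope group_scope.

Definition posnat := {n : nat | (0 < n)%N}.

Record beta (X : Type) := Beta {
  ultra_sets :> set X -> Prop;
  ultraP : UltraFilter ultra_sets }.

HB.instance Definition _ (X : Type) := gen_eqMixin (beta X).
HB.instance Definition _ (X : Type) := gen_choiceMixin (beta X).

Lemma beta_eq (X : Type) (p q : beta X) : ultra_sets p = ultra_sets q -> p = q.
Proof.
case: p q => [p pU] [q qU] /= pq; move: pU; rewrite {p}pq => pU.
by congr Beta; exact: Prop_irrelevance.
Qed.

Section BetaMul.
Variable X : semigroupType.
Implicit Types p q r : beta X.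

(* The product making beta X right topological: A belongs to p * q
   iff {x | x^-1 A \in q} belongs to p. *)
Definition beta_mul_sets p q : set X -> Prop :=
  fun A => p [set x | q [set y | A (x * y)]].

Lemma beta_mul_ultra p q : UltraFilter (beta_mul_sets p q).
Proof.
have pU := ultraP p; have qU := ultraP q.
have FF : ProperFilter (beta_mul_sets p q).
  split.
    rewrite /beta_mul_sets /= => p0; apply: (@filter_not_empty _ p).
    apply: (filterS _ p0) => x /= q0; apply: (@filter_not_empty _ q).
    exact: (filterS _ q0).
  split; rewrite /beta_mul_sets /=.
  - by apply: filterS filterT => x _ /=; apply: filterS filterT.
  - move=> A B pA pB; apply: (filterS _ (filterI pA pB)) => x [/= qA qB].
    exact: filterI.
  - move=> A B AB; apply: filterS => x /=; apply: filterS => y /=; exact: AB.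
split=> // G GF sG; apply/seteqP; split=> // A GA.
have [//|pNA] := in_ultra_setVsetC [set x | q [set y | A (x * y)]] pU.
exfalso; apply: (@filter_not_empty _ G); rewrite -(setICr A).
apply: filterI => //; apply: sG; apply: (filterS _ pNA) => x /= NqA.
by have [//|] := in_ultra_setVsetC [set y | A (x * y)] qU.
Qed.

Definition beta_mul p q : beta X := Beta (beta_mul_ultra p q).

Lemma beta_mulA : associative beta_mul.
Proof.
move=> p q r; apply: beta_eq => /=.
rewrite /beta_mul_sets; apply/funext => A /=.
congr (p _); apply/funext => x; congr (q _); apply/funext => y.
by congr (r _); apply/funext => z /=; rewrite mulgA.
Qed.

HB.instance Definition _ := isSemigroup.Build (beta X) beta_mulA.

End BetaMul.

Definition ideal (T : semigroupType) (I : set T) : Prop :=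
  I !=set0 /\ forall x y : T, I y -> I (x * y) /\ I (y * x).

(* In a semigroup possessing a smallest ideal, such as beta X, this
   intersection is that ideal. *)
Definition smallest_ideal (T : semigroupType) : set T :=
  \bigcap_(I in @ideal T) I.

Definition piecewise_syndetic (X : semigroupType) (D : set X) : Prop :=
  exists2 p : beta X, smallest_ideal p & p D.

Record nword (T : Type) := NWord {
  letters :> seq T;
  _ : ~~ nilp letters }.

HB.instance Definition _ (T : Type) := [isSub for @letters T].
HB.instance Definition _ (T : choiceType) := [Choice of nword T by <:].

Section NWordMul.
Variable T : Type.

Lemma nword_cat_subproof (u v : nword T) : ~~ nilp (u ++ v).
Proof. by case: u => -[]. Qed.

Definition nword_mul (u v : nword T) : nword T :=
  NWord (nword_cat_subproof u v).

Lemma nword_mulA : associative nword_mul.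
Proof. by move=> u v w; apply: val_inj; rewrite /= catA. Qed.

Lemma nword_map_subproof (U : Type) (f : T -> U) (w : nword T) :
  ~~ nilp (map f w).
Proof. by case: w => -[]. Qed.

Definition nword_map (U : Type) (f : T -> U) (w : nword T) : nword U :=
  NWord (nword_map_subproof f w).

End NWordMul.

HB.instance Definition _ (T : choiceType) :=
  isSemigroup.Build (nword T) (@nword_mulA T).

Section VarWords.
Variables (A : finType) (n : nat).

(* In A + 'I_n, inl a is the letter a and inr i is the variable v_(i+1). *)
Definition all_vars (w : nword (A + 'I_n)) : bool :=
  [forall i : 'I_n, inr i \in letters w].

Record vword := VWord {
  vword_val :> nword (A + 'I_n);
  _ : all_vars vword_val }.

HB.instance Definition _ := [isSub for vword_val].
HB.instance Definition _ := [Choice of vword by <:].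

Lemma all_vars_mulg_closed : mulg_closed all_vars.
Proof.
move=> u v /forallP uP _; apply/forallP => i.
by rewrite mem_cat uP.
Qed.

HB.instance Definition _ :=
  SubChoice_isSubSemigroup.Build _ _ vword all_vars_mulg_closed.

Definition mu (j : 'I_n) (w : vword) : nat := count_mem (inr j) (letters w).

Definition subst_letter (x : n.-tuple A) (s : A + 'I_n) : A :=
  match s with inl a => a | inr i => tnth x i end.

Definition hsubst (x : n.-tuple A) (w : vword) : nword A :=
  nword_map (subst_letter x) w.

Lemma hsubst_is_multiplicative (x : n.-tuple A) : {morph hsubst x : u v / u * v}.
Proof. by move=> u v; apply: val_inj; rewrite /= map_cat. Qed.

HB.instance Definition _ (x : n.-tuple A) :=
  isMultiplicative.Build vword (nword A) (hsubst x) (hsubst_is_multiplicative x).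

Definition h_family : set {multiplicative vword -> nword A} :=
  [set (hsubst x : {multiplicative vword -> nword A}) | x in [set: n.-tuple A]].

Lemma h_family_finite : finite_set h_family.
Proof. exact/finite_image/finite_finset. Qed.

Lemma h_family_neq0 : (0 < #|A|)%N -> h_family !=set0.
Proof.
move=> /card_gt0P[a _]; exists (hsubst (nseq_tuple n a)).
by exists (nseq_tuple n a).
Qed.

(* The equality in rat says that the i-th entry of the product of M with the
   column (mu (sigma 1) w, ..., mu (sigma m) w) is a positive integer that
   belongs to B i. *)
Definition Pset (k m : nat) (M : 'M[rat]_(k, m))
    (F : set {multiplicative vword -> nword A})
    (sigma : 'I_m -> 'I_n) : set ('I_k -> beta posnat) :=
  [set p | forall (D : set (nword A)) (B : 'I_k -> set posnat),
     piecewise_syndetic D -> (forall i, p i (B i)) ->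
     exists w : vword,
       (forall nu : {multiplicative vword -> nword A}, F nu -> D (nu w)) /\
       (forall i : 'I_k, exists2 b : posnat, B i b &
          ((M *m \col_(j < m) ((mu (sigma j) w)%:R : rat)) i ord0
           = (val b)%:R)%R)].

End VarWords.

(* Main.v *)
Require Import Defs.
From mathcomp Require Import all_boot all_algebra all_classical.
From mathcomp Require Import perm action primitive_action alt.

(* Renaming the variables by a permutation s of the indices with
   s (sigma j) = eta j turns a witness for sigma into one for eta: the
   substitution instances of the renamed word are those of the original one,
   for a permuted parameter tuple. *)

(** The symmetric group of [T] is [#|T|]-transitive, hence [#|I|]-transitive, as [f] gives
    [#|I| <= #|T|]. It therefore carries the duplicate-free tuple of values of [f] to that of
    [g]. *)
Lemma perm_extension {T I : finType} (f g : I -> T) :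
  injective f -> injective g -> exists s : {perm T}, forall i, s (f i) = g i.
Proof.
move=> f_inj g_inj.
have dt (h : I -> T) : injective h ->
    map_tuple h (enum_tuple I) \in (#|I|).-dtuple([set: T]).
  move=> h_inj; rewrite inE map_inj_uniq // enum_uniq.
  by apply/fintype.subsetP => x; rewrite finset.in_setT.
have /(ntransitive_weak (leq_card f f_inj)) tr := Sym_trans T.
have [s _ fgs] := atransP2 tr (dt f f_inj) (dt g g_inj).
exists s => i.
move/(congr1 val): fgs; rewrite /= -map_comp => /eq_in_map -> //.
by rewrite mem_enum.
Qed.

Section RenameVars.
Context {A : finType} {n : nat}.
Implicit Types (s : {perm 'I_n}) (w : vword A n).

Definition rename_letter s (a : A + 'I_n) : A + 'I_n :=
  match a with inl a => inl a | inr i => inr (s i) end.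

Lemma rename_letter_inj s : injective (rename_letter s).
Proof. by move=> [a|i] [b|j] //= [E]; congr (_ _) => //; apply: perm_inj E. Qed.

Lemma all_vars_rename s w : all_vars (nword_map (rename_letter s) w).
Proof.
(* Surjectivity of [s]: the variable [i] is the renamed variable [s^-1 i], which occurs in [w]. *)
apply/forallP => i; rewrite -[i](permKV s).
rewrite -[inr _]/(rename_letter s (inr (s^-1 i)%g)).
rewrite (mem_map (rename_letter_inj s)).
by case: w => w /= /forallP.
Qed.

Definition rename s w : vword A n := VWord (all_vars_rename s w).

Lemma mu_rename s i w : mu (s i) (rename s w) = mu i w.
Proof.
rewrite /mu /= count_map; apply: eq_count => a /=.
exact: (inj_eq (rename_letter_inj s) a (inr i)).
Qed.

Lemma hsubst_rename s (x : n.-tuple A) w :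
  hsubst x (rename s w) = hsubst [tuple tnth x (s i) | i < n] w.
Proof.
apply: val_inj; rewrite /= -map_comp; apply: eq_map => -[a|i] //=.
by rewrite tnth_mktuple.
Qed.

End RenameVars.

Lemma Pset_sub_perm (A : finType) (k m n : nat) (M : 'M[rat]_(k, m))
    (sigma eta : 'I_m -> 'I_n) (s : {perm 'I_n}) :
  (forall j, s (sigma j) = eta j) ->
  (Pset M (@h_family A n) sigma `<=` Pset M (@h_family A n) eta)%classic.
Proof.
move=> seta p pP D B psD pB; have [w [Dw Bw]] := pP D B psD pB.
exists (rename s w); split=> [_ [x _ <-]|i].
  (* The family contains the substitutions for all tuples, so it also contains the one for the
     permuted tuple. *)
  rewrite /= hsubst_rename; apply: Dw.
  by exists [tuple tnth x (s i) | i < n].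
have [b Bb wb] := Bw i; exists b => //; rewrite -wb !mxE.
(* The two count columns agree entrywise, since [eta j] is [s (sigma j)]; so [b] still serves. *)
by apply: eq_bigr => j _; rewrite !mxE -seta mu_rename.
Qed.

Theorem theorem4p3 (A : finType) (hA : (0 < #|A|)%N)
    (k m n : nat) (hk : (0 < k)%N) (hm : (0 < m)%N) (hmn : (m <= n)%N)
    (M : 'M[rat]_(k, m))
    (sigma eta : 'I_m -> 'I_n)
    (hsigma : injective sigma) (heta : injective eta) :
  Pset M (@h_family A n) sigma = Pset M (@h_family A n) eta.
Proof.
have [s sE] := perm_extension sigma eta hsigma heta.
have [t tE] := perm_extension eta sigma heta hsigma.
by apply/seteqP; split; [apply: Pset_sub_perm sE | apply: Pset_sub_perm tE].
Qed.
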